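(* Let $G$ be a distinguished group and let $A_1,A_2,\dots,A_\sigma$ be subgroups of $G$, all of the same order $v$, such that every product $A_i.A_k$ ($i,k=1,\dots,\sigma$) is also a subgroup of $G$ of order $v$. Then there is a set $\mathcal{S}$ of subgroups of $G$, each of order $v$, with $A_1,\dots,A_\sigma\in\mathcal{S}$, such that $\mathcal{S}$ with the composition $(X,Y)\mapsto X.Y$ is a distributive group.
   Context: A distributive group is a nonempty set $G$ with a binary operation $(a,b)\mapsto a.b$ on $G$ such that for all $a,b\in G$ each of the equations $a.x=b$ and $y.a=b$ has exactly one solution in $G$, and for all $a,b,c\in G$, $(a.b).c=(a.c).(b.c)$ and $c.(a.b)=(c.a).(c.b)$. A subgroup of $G$ is a nonempty subset which is itself a distributive group under the restricted operation; the order is the number of elements. For subsets $X,Y\subseteq G$ and $p\in G$: $X.Y=\{x.y: x\in X,\,y\in Y\}$, $X.p=\{x.p: x\in X\}$, $p.X=\{p.x:x\in X\}$. A finite distributive group $G$ is called distinguished if for every subgroup $A$ of $G$ and every $p\in G$, the sets $A.(A.p)$ and $(A.p).A$ are subgroups of the same order as $A$; equivalently there are $t,\tau\in G$ with $A.(A.p)=A.t$ and $(A.p).A=A.(p.A)=A.\tau$. *)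

(* Defs.v *)
From mathcomp Require Import all_boot.

Set Implicit Arguments.
Unset Strict Implicit.
Unset Printing Implicit Defensive.

(* [distributive_group op A] : the subset [A], with the operation [op]
   restricted to it, is a distributive group (a nonempty quasigroup that is
   left and right distributive).  Stated for subsets, the same definition
   covers a whole group ([A := [set: T]]), its subgroups, and families of
   subsets with the complex product ([T := {set T'}]). *)
Definition distributive_group (T : finType) (op : T -> T -> T) (A : {set T})
    : Prop :=
  [/\ A != set0,
      {in A &, forall a b, op a b \in A},
      {in A &, forall a b, (exists! x, x \in A /\ op a x = b)
                        /\ (exists! y, y \in A /\ op y a = b)},
      {in A & &, forall a b c, op (op a b) c = op (op a c) (op b c)}
    & {in A & &, forall a b c, op c (op a b) = op (op c a) (op c b)}].

Definition set_op (T : finType) (op : T -> T -> T) (X Y : {set T}) : {set T} :=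
  [set op x y | x in X, y in Y].

Definition rtranslate (T : finType) (op : T -> T -> T) (X : {set T}) (p : T)
    : {set T} :=
  [set op x p | x in X].

Definition distinguished (T : finType) (op : T -> T -> T) : Prop :=
  distributive_group op [set: T] /\
  forall (A : {set T}) (p : T), distributive_group op A ->
    let Ap := rtranslate op A p in
    [/\ distributive_group op (set_op op A Ap),
        #|set_op op A Ap| = #|A|,
        distributive_group op (set_op op Ap A)
      & #|set_op op Ap A| = #|A| ].

(* Main.v *)
Require Import Defs.
From mathcomp Require Import all_boot.

(** Let [F] be a family of [v]-element sets all of whose pairwise products
    [X.Y] have [v] elements.  Since every translation is injective, each
    product [X.Y] contains the [v]-element sets [x.Y] and [X.y], hence equals
    all of them ([set_opEl], [set_opEr]): a product of two members may be
    computed as a translate by one element.  Everything follows from this.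

    - Adjoining a product [A.B] to [F] keeps all products of size [v].  Indeed
      [(A.B).C] is contained in [(A.C).(B.C)], and since [A.C = A.c] and
      [B.C = B.c] for one and the same [c] in [C], this is [(A.c).(B.c)], that
      is [(A.B).c], which has [v] elements ([set_op_distrr], and
      [set_op_distrl] on the other side).  As there are finitely many sets, a
      maximal family of this kind containing the [A_i] is therefore closed
      under products ([max_equicard_closed]).

    - In a closed family the two distributive laws hold by the same
      computation, and cancellation is inherited from the translations of [G]:
      [X.Y = X'.Y] gives [X.y = X'.y], so [X = X'].  On a finite set this makes
      the family a distributive group ([equicard_distributive_group]).

    - Each member [X] is a subgroup: idempotence of [G] gives that [X] is
      contained in [X.X], which has the same size, so [X] is closed, and a
      nonempty closed subset of a finite distributive group is a subgroup. *)

Set Implicit Arguments.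
Unset Strict Implicit.
Unset Printing Implicit Defensive.

(** * Finite distributive groups by cancellation *)

Lemma in_inj_exists_unique (T : finType) (f : T -> T) (A : {set T}) (b : T) :
  {in A, forall x, f x \in A} -> {in A &, injective f} -> b \in A ->
  exists! x, x \in A /\ f x = b.
Proof.
move=> fA f_inj; have {1}<- : f @: A = A.
  apply/eqP; rewrite eqEcard card_in_imset // leqnn andbT.
  by apply/subsetP => _ /imsetP[x xA ->]; apply: fA.
by case/imsetP => x xA ->; exists x; split=> // y [yA fyx]; apply: f_inj.
Qed.

(** On a finite set the unique solvability of both equations is just two-sided
    cancellation.  This is the form in which the axioms are checked, both for
    subsets of [G] and for a family of subsets under the product. *)
Lemma cancel_distributive_group (T : finType) (op : T -> T -> T) (A : {set T}) :
  A != set0 ->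
  {in A &, forall a b, op a b \in A} ->
  {in A, forall a, {in A &, injective (op a)}} ->
  {in A, forall a, {in A &, injective (op^~ a)}} ->
  {in A & &, forall a b c, op (op a b) c = op (op a c) (op b c)} ->
  {in A & &, forall a b c, op c (op a b) = op (op c a) (op c b)} ->
  distributive_group op A.
Proof.
move=> A0 opA injl injr distr distl; split=> // a b aA bA; split.
  by apply: in_inj_exists_unique bA; [move=> x xA; apply: opA | apply: injl].
by apply: (in_inj_exists_unique (f := op^~ a)) bA;
  [move=> x xA; apply: opA | apply: injr].
Qed.

Section DistributiveGroup.

Context (G : finType) (op : G -> G -> G).
Context (hG : distributive_group op [set: G]).

Local Notation "X ** Y" := (set_op op X Y) (at level 40, left associativity).

Lemma op_distr a b c : op (op a b) c = op (op a c) (op b c).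
Proof. by case: hG => _ _ _ distr _; apply: distr; rewrite inE. Qed.

Lemma op_distl a b c : op c (op a b) = op (op c a) (op c b).
Proof. by case: hG => _ _ _ _ distl; apply: distl; rewrite inE. Qed.

Lemma op_injl a : injective (op a).
Proof.
case: hG => _ _ solv _ _ x y eq_xy.
have [[z [_ z_uniq]] _] := solv a (op a y) (in_setT _) (in_setT _).
by rewrite -(z_uniq x) ?(z_uniq y) // inE.
Qed.

Lemma op_injr a : injective (op^~ a).
Proof.
case: hG => _ _ solv _ _ x y eq_xy.
have [_ [z [_ z_uniq]]] := solv a (op y a) (in_setT _) (in_setT _).
by rewrite -(z_uniq x) ?(z_uniq y) // inE.
Qed.

Lemma op_idem x : op x x = x.
Proof. by apply/esym/(@op_injl (op x x)); rewrite -op_distr. Qed.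

Lemma closed_distributive_group (X : {set G}) :
  X != set0 -> {in X &, forall x y, op x y \in X} -> distributive_group op X.
Proof.
move=> X0 opX; apply: cancel_distributive_group => //.
- by move=> a _ x y _ _; apply: op_injl.
- by move=> a _ x y _ _; apply: op_injr.
- by move=> a b c _ _ _; apply: op_distr.
- by move=> a b c _ _ _; apply: op_distl.
Qed.

(** * Products of subsets as translates *)

Lemma sub_translatel (X Y : {set G}) a : a \in X -> op a @: Y \subset X ** Y.
Proof. by move=> aX; apply/subsetP => _ /imsetP[y yY ->]; apply: imset2_f. Qed.

Lemma sub_translater (X Y : {set G}) b : b \in Y -> op^~ b @: X \subset X ** Y.
Proof. by move=> bY; apply/subsetP => _ /imsetP[x xX ->]; apply: imset2_f. Qed.

Lemma set_opEl (X Y : {set G}) a :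
  #|X ** Y| = #|Y| -> a \in X -> X ** Y = op a @: Y.
Proof.
move=> cXY aX; apply/esym/eqP; rewrite eqEcard sub_translatel //.
by rewrite cXY (card_imset _ (@op_injl a)) leqnn.
Qed.

Lemma set_opEr (X Y : {set G}) b :
  #|X ** Y| = #|X| -> b \in Y -> X ** Y = op^~ b @: X.
Proof.
move=> cXY bY; apply/esym/eqP; rewrite eqEcard sub_translater //.
by rewrite cXY (card_imset _ (@op_injr b)) leqnn.
Qed.

(** Elementwise, distributivity only puts [(A.B).C] inside [(A.C).(B.C)],
    because on the right the two elements of [C] may differ; when a single
    translation by [c] produces both [A.C] and [B.C], the inclusion closes up
    through [(A.c).(B.c) = (A.B).c]. *)
Lemma set_op_distrr (A B C : {set G}) c : c \in C ->
    A ** C = op^~ c @: A -> B ** C = op^~ c @: B ->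
  (A ** B) ** C = (A ** C) ** (B ** C)
  /\ (A ** B) ** C = op^~ c @: (A ** B).
Proof.
move=> cC AC BC.
have sub1 : (A ** B) ** C \subset (A ** C) ** (B ** C).
  apply/subsetP => _ /imset2P[_ z /imset2P[x y xA yB ->] zC ->].
  by rewrite op_distr !imset2_f.
have sub2 : (A ** C) ** (B ** C) \subset op^~ c @: (A ** B).
  rewrite AC BC; apply/subsetP.
  move=> _ /imset2P[_ _ /imsetP[x xA ->] /imsetP[y yB ->] ->].
  by rewrite -op_distr; apply/(imset_f (op^~ c))/imset2_f.
have sub3 := sub_translater (A ** B) cC.
by split; apply/eqP; rewrite eqEsubset ?sub1 ?(subset_trans sub2 sub3)
  ?(subset_trans sub1 sub2).
Qed.

Lemma set_op_distrl (A B C : {set G}) c : c \in C ->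
    C ** A = op c @: A -> C ** B = op c @: B ->
  C ** (A ** B) = (C ** A) ** (C ** B)
  /\ C ** (A ** B) = op c @: (A ** B).
Proof.
move=> cC CA CB.
have sub1 : C ** (A ** B) \subset (C ** A) ** (C ** B).
  apply/subsetP => _ /imset2P[z _ zC /imset2P[x y xA yB ->] ->].
  by rewrite op_distl !imset2_f.
have sub2 : (C ** A) ** (C ** B) \subset op c @: (A ** B).
  rewrite CA CB; apply/subsetP.
  move=> _ /imset2P[_ _ /imsetP[x xA ->] /imsetP[y yB ->] ->].
  by rewrite -op_distl; apply/(imset_f (op c))/imset2_f.
have sub3 := sub_translatel (A ** B) cC.
by split; apply/eqP; rewrite eqEsubset ?sub1 ?(subset_trans sub2 sub3)
  ?(subset_trans sub1 sub2).
Qed.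

(** * Families with all products of the same size *)

(** Being a boolean condition on sizes, it can be maximised over families; that
    the members are subgroups is recovered in [equicard_subgroup]. *)
Definition equicard (v : nat) (F : {set {set G}}) : bool :=
  [forall X in F, (#|X| == v) && [forall Y in F, #|X ** Y| == v]].

Lemma equicardP v (F : {set {set G}}) :
  reflect ({in F, forall X : {set G}, #|X| = v} /\
           {in F &, forall X Y, #|X ** Y| = v})
          (equicard v F).
Proof.
apply: (iffP forall_inP) => [H | [cF cFF] X XF].
  split=> [X /H/andP[/eqP] // | X Y /H/andP[_ /forall_inP XF] /XF/eqP //].
by rewrite cF // eqxx; apply/forall_inP => Y YF; rewrite cFF.
Qed.

Section FixedSize.

Context (v : nat) (v_gt0 : 0 < v).

Lemma card_pos_mem (X : {set G}) : #|X| = v -> exists x, x \in X.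
Proof. by move=> cX; apply/set0Pn; rewrite -card_gt0 cX. Qed.

Lemma card_set_op_distrr (A B C : {set G}) :
    #|A| = v -> #|B| = v -> #|C| = v ->
    #|A ** B| = v -> #|A ** C| = v -> #|B ** C| = v ->
  (A ** B) ** C = (A ** C) ** (B ** C) /\ #|(A ** B) ** C| = v.
Proof.
move=> cA cB cC cAB cAC cBC; have [c Cc] := card_pos_mem cC.
have [|| distr E] := @set_op_distrr A B C c Cc.
- by apply: set_opEr; rewrite ?cA.
- by apply: set_opEr; rewrite ?cB.
by split; rewrite // E (card_imset _ (@op_injr c)).
Qed.

Lemma card_set_op_distrl (A B C : {set G}) :
    #|A| = v -> #|B| = v -> #|C| = v ->
    #|A ** B| = v -> #|C ** A| = v -> #|C ** B| = v ->
  C ** (A ** B) = (C ** A) ** (C ** B) /\ #|C ** (A ** B)| = v.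
Proof.
move=> cA cB cC cAB cCA cCB; have [c Cc] := card_pos_mem cC.
have [|| distr E] := @set_op_distrl A B C c Cc.
- by apply: set_opEl; rewrite ?cA.
- by apply: set_opEl; rewrite ?cB.
by split; rewrite // E (card_imset _ (@op_injl c)).
Qed.

Lemma equicard_subgroup (F : {set {set G}}) (X : {set G}) :
  equicard v F -> X \in F -> distributive_group op X.
Proof.
case/equicardP => cF cFF XF; have cX := cF _ XF.
apply: closed_distributive_group; first by rewrite -card_gt0 cX.
have XX : X = X ** X.
  apply/eqP; rewrite eqEcard cFF // cX leqnn andbT.
  by apply/subsetP => x xX; rewrite -(op_idem x) imset2_f.
by move=> x y xX yX; rewrite XX imset2_f.
Qed.

Lemma equicard_adjoin (F : {set {set G}}) (A B : {set G}) :
  equicard v F -> A \in F -> B \in F -> equicard v (A ** B |: F).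
Proof.
case/equicardP => cF cFF AF BF.
have cAB : #|A ** B| = v by apply: cFF.
have cABr C : C \in F -> #|(A ** B) ** C| = v.
  by move=> CF; apply: (card_set_op_distrr _ _ _ _ _ _).2; auto.
have cABl C : C \in F -> #|C ** (A ** B)| = v.
  by move=> CF; apply: (card_set_op_distrl _ _ _ _ _ _).2; auto.
(* The square of [A.B] is the case [C = A.B] of right distributivity, as
   [A.(A.B)] and [B.(A.B)] are already known to have [v] elements. *)
have cABAB : #|(A ** B) ** (A ** B)| = v.
  by apply: (card_set_op_distrr _ _ _ _ _ _).2; auto.
apply/equicardP; split=> [X | X Y]; rewrite !inE.
  by case/predU1P => [-> | /cF].
by case/predU1P => [-> | XF] /predU1P[-> | YF]; auto.
Qed.

Lemma max_equicard_closed (S : {set {set G}}) :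
  maxset (equicard v) S -> {in S &, forall X Y, X ** Y \in S}.
Proof.
case/maxsetP => eS maxS X Y XS YS.
by rewrite -(maxS _ (equicard_adjoin eS XS YS) (subsetUr _ _)) setU11.
Qed.

Lemma equicard_distributive_group (S : {set {set G}}) :
  S != set0 -> equicard v S -> {in S &, forall X Y, X ** Y \in S} ->
  distributive_group (set_op op) S.
Proof.
move=> S0 /equicardP[cS cSS] opS; apply: cancel_distributive_group => //.
- move=> A AS X Y XS YS /= eqXY; have [a aA] := card_pos_mem (cS _ AS).
  by apply: (imset_inj (@op_injl a)); rewrite -!(set_opEl _ aA) ?cSS ?cS.
- move=> A AS X Y XS YS /= eqXY; have [a aA] := card_pos_mem (cS _ AS).
  by apply: (imset_inj (@op_injr a)); rewrite -!(set_opEr _ aA) ?cSS ?cS.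
- by move=> A B C *; apply: (card_set_op_distrr _ _ _ _ _ _).1; auto.
- by move=> A B C *; apply: (card_set_op_distrl _ _ _ _ _ _).1; auto.
Qed.

End FixedSize.

End DistributiveGroup.

(** * Embedding a family of subgroups in a distributive group of subgroups *)

Theorem theorem5p4 (G : finType) (op : G -> G -> G) (sigma v : nat)
    (A : 'I_sigma -> {set G})
    (hG : distinguished op)
    (hsigma : 0 < sigma)
    (hA : forall i, distributive_group op (A i) /\ #|A i| = v)
    (hAA : forall i k, distributive_group op (set_op op (A i) (A k))
                       /\ #|set_op op (A i) (A k)| = v) :
  exists S : {set {set G}},
    [/\ (forall X, X \in S -> distributive_group op X /\ #|X| = v),
        (forall i, A i \in S)
      & distributive_group (set_op op) S].
Proof.
case: hG => dG _; pose i0 := Ordinal hsigma.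
have v_gt0 : 0 < v.
  by have [[A0 _ _ _ _] <-] := hA i0; rewrite card_gt0.
have eA : equicard op v [set A i | i : 'I_sigma].
  apply/equicardP; split=> [_ /imsetP[i _ ->] | ]; first by case: (hA i).
  by move=> _ _ /imsetP[i _ ->] /imsetP[k _ ->]; case: (hAA i k).
have [S maxS sAS] := maxset_exists eA.
have AS i : A i \in S by apply: (subsetP sAS); apply: imset_f.
have eS : equicard op v S := maxsetp maxS.
exists S; split=> // [X XS | ].
  split; first exact: (equicard_subgroup dG v_gt0 eS XS).
  by case/equicardP: eS => cS _; apply: cS.
apply: (equicard_distributive_group dG v_gt0) => //.
- by apply/set0Pn; exists (A i0).
- exact: (max_equicard_closed dG v_gt0 maxS).
Qed.
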